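(* Let $H_1$ and $H_2$ be separable complex Hilbert spaces, let $H=H_1\otimes H_2$, and let $(X,\mu)=(X_1\times X_2,\mu_1\otimes\mu_2)$ be the product of measure spaces $(X_1,\mu_1)$, $(X_2,\mu_2)$ with $\sigma$-finite positive measures $\mu_1,\mu_2$. Let $F_1:X_1\to H_1$ and $F_2:X_2\to H_2$ be mappings and let $F=F_1\otimes F_2:X\to H$, $F(x_1,x_2)=F_1(x_1)\otimes F_2(x_2)$. Then $F$ is a phase retrieval continuous frame for $H$ with respect to $(X,\mu)$ if and only if $F_1$ is a phase retrieval continuous frame for $H_1$ with respect to $(X_1,\mu_1)$ and $F_2$ is a phase retrieval continuous frame for $H_2$ with respect to $(X_2,\mu_2)$.
   Context: $H_1\otimes H_2$ denotes the Hilbert space tensor product, realized as the space of all antilinear maps $T:H_2\to H_1$ with $\sum_j\|T\alpha_j\|^2<\infty$ for an orthonormal basis $\{\alpha_j\}$ of $H_2$, with inner product $\langle T_1,T_2\rangle=\sum_j\langle T_1\alpha_j,T_2\alpha_j\rangle$. For $f\in H_1$, $g\in H_2$, $f\otimes g$ is the map $(f\otimes g)(t)=\langle g,t\rangle f$, $t\in H_2$, and $\langle f_1\otimes g_1,f_2\otimes g_2\rangle=\langle f_1,f_2\rangle\langle g_1,g_2\rangle$. For a Hilbert space $K$ and a measure space $(Y,\nu)$, a continuous frame for $K$ with respect to $(Y,\nu)$ is a mapping $\Phi:Y\to K$ such that $y\mapsto\langle f,\Phi(y)\rangle$ is measurable for every $f\in K$ and there are constants $0<A\le B<\infty$ with $A\|f\|^2\le\int_Y|\langle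 f,\Phi(y)\rangle|^2\,d\nu(y)\le B\|f\|^2$ for all $f\in K$. It is phase retrieval if for all $f,g\in K$, the condition $|\langle f,\Phi(y)\rangle|=|\langle g,\Phi(y)\rangle|$ for $\nu$-almost all $y\in Y$ implies $f=e^{i\theta}g$ for some $\theta\in\mathbb{R}$.
   Formalization: H1 and H2 are assumed nonzero: if H1 = 0 and H2 is nonzero, then H = 0 and every F is trivially a phase retrieval frame, so ''only if'' fails. The antilinear maps forming the tensor product are required to be continuous, without which the inner product is degenerate. *)

(* Defs.v *)
From HB Require Import structures.
From mathcomp Require Import all_boot all_order all_algebra.
From mathcomp Require Import all_classical all_reals all_analysis.
From mathcomp Require Import complex.
From mathcomp Require Import ring lra.
Set Implicit Arguments. Unset Strict Implicit. Unset Printing Implicit Defensive.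
Import Order.TTheory GRing.Theory Num.Theory.
Import numFieldNormedType.Exports.
Local Open Scope classical_set_scope.
Local Open Scope ring_scope.
Local Open Scope complex_scope.

(* The inner product is linear in its first argument. *)
HB.mixin Record NormedModule_hasInner (R : realType) V & NormedModule R[i] V := {
  inner : V -> V -> R[i];
  inner_scalar : forall z, scalar (inner ^~ z);
  innerC : forall x y, inner x y = Num.conj (inner y x);
  sqr_normE : forall x, `|x| ^+ 2 = inner x x
}.

#[short(type="innerType")]
HB.structure Definition Inner (R : realType) :=
  {V of NormedModule R[i] V & NormedModule_hasInner R V}.

#[short(type="hilbertType")]
HB.structure Definition Hilbert (R : realType) :=
  {V of Inner R V & Complete V}.

Section dot.
Variables (C : numClosedFieldType) (U : lmodType C).

Lemma dot_sqr_le (f : {dot U for (@Num.conj C)}) u v :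
  `|f u v| ^+ 2 <= f u u * f v v.
Proof.
have [->|v0] := eqVneq v 0.
  by rewrite !linear0r normr0 expr0n.
have fv0 : f v v != 0 by rewrite dnorm_eq0.
pose a := f u v / f v v; pose u1 := u - a *: v.
have o1 : f u1 v = 0.
  by rewrite linearBl/= linearZl_LR/= /a divfK// subrr.
have uE : u = u1 + a *: v by rewrite /u1 subrK.
have fuv : f u v = a * f v v by rewrite /a divfK.
rewrite fuv normrM exprMn (ger0_norm (dnorm_ge0 f v)).
rewrite uE hnormDd/=; last by rewrite linearZr_LR/= o1 mulr0.
rewrite dnormZ mulrDl expr2 mulrA lerDr.
by rewrite mulr_ge0// dnorm_ge0.
Qed.

End dot.

HB.factory Record Lmodule_isInner (R : realType) V & GRing.Lmodule R[i] V := {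
  inner : V -> V -> R[i];
  inner_scalar : forall z, scalar (inner ^~ z);
  innerC : forall x y, inner x y = Num.conj (inner y x);
  inner_gt0 : forall x, x != 0 -> 0 < inner x x
}.

HB.builders Context R V & Lmodule_isInner R V.

Let innerr u : GRing.linear_for (Num.conj \; *%R) (inner u).
Proof.
move=> a x y.
by rewrite innerC inner_scalar rmorphD rmorphM/= -!innerC.
Qed.

HB.instance Definition _ :=
  @bilinear_isBilinear.Build R[i] V V R[i] *%R (Num.conj \; *%R) inner
    (conj inner_scalar innerr).

Let innerC' x y : inner x y = (-1) ^+ false * Num.conj (inner y x).
Proof. by rewrite expr0 mul1r innerC. Qed.

HB.instance Definition _ :=
  isHermitianSesquilinear.Build R[i] V false Num.conj inner innerC'.

HB.instance Definition _ := isDotProduct.Build R[i] V inner inner_gt0.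

Let dot : {dot V for (@Num.conj R[i])} := inner.

Let norm x : R[i] := sqrtC (inner x x).

Let inner_ge0 x : 0 <= inner x x. Proof. exact: (dnorm_ge0 dot). Qed.

Let norm_le x y : norm (x + y) <= norm x + norm y.
Proof.
rewrite -(@ler_pXn2r _ 2) ?nnegrE ?addr_ge0 ?sqrtC_ge0 ?inner_ge0//.
rewrite sqrrD !sqrtCK (dnormD dot)/= addrAC lerD2r lerD2l.
set d := inner x y.
have dr : d + Num.conj d \is Num.real by rewrite CrealE rmorphD/= conjCK addrC.
apply: (le_trans (real_ler_norm dr)).
rewrite (le_trans (ler_normD _ _))// norm_conjC -mulr2n.
rewrite lerMn2r/= -(@ler_pXn2r _ 2) ?nnegrE ?mulr_ge0 ?sqrtC_ge0 ?inner_ge0//.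
by rewrite exprMn !sqrtCK; exact: (dot_sqr_le dot).
Qed.

Let normZ a x : norm (a *: x) = `|a| * norm x.
Proof.
rewrite /norm (dnormZ dot) sqrtCM ?nnegrE ?exprn_ge0 ?inner_ge0//.
by rewrite sqrCK.
Qed.

Let norm0 x : norm x = 0 -> x = 0.
Proof. by move=> /eqP; rewrite sqrtC_eq0 (dnorm_eq0 dot) => /eqP. Qed.

HB.instance Definition _ :=
  Lmodule_isNormed.Build R[i] V norm_le normZ norm0.

Let sqr_norm x : `|x| ^+ 2 = inner x x.
Proof. exact: sqrtCK. Qed.

HB.instance Definition _ := NormedModule_hasInner.Build R V
  inner_scalar innerC sqr_norm.

HB.end.

Section inner_theory.
Variables (R : realType) (V : innerType R).

Let innerr (u : V) : GRing.linear_for (Num.conj \; *%R) (inner u).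
Proof.
move=> a x y.
by rewrite innerC inner_scalar rmorphD rmorphM/= -!innerC.
Qed.

HB.instance Definition _ :=
  @bilinear_isBilinear.Build R[i] V V R[i] *%R (Num.conj \; *%R) (@inner R V)
    (conj inner_scalar innerr).

Let innerC' (x y : V) : inner x y = (-1) ^+ false * Num.conj (inner y x).
Proof. by rewrite expr0 mul1r innerC. Qed.

HB.instance Definition _ :=
  isHermitianSesquilinear.Build R[i] V false Num.conj (@inner R V) innerC'.

Let inner_gt0 (x : V) : x != 0 -> 0 < inner x x.
Proof. by move=> x0; rewrite -sqr_normE exprn_gt0// normr_gt0. Qed.

HB.instance Definition _ := isDotProduct.Build R[i] V (@inner R V) inner_gt0.

Definition innerdot : {dot V for (@Num.conj R[i])} := @inner R V.

Lemma inner_le (x y : V) : `|inner x y| <= `|x| * `|y|.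
Proof.
rewrite -(@ler_pXn2r _ 2) ?nnegrE ?mulr_ge0//.
by rewrite exprMn !sqr_normE (dot_sqr_le innerdot).
Qed.

End inner_theory.

(* On a normed module over R[i] the library's norm takes values in R[i]; rnorm
   is the same norm as an element of R (on R[i]^o it is the modulus). *)
Definition rnorm (R : realType) (V : normedModType R[i]) (x : V) : R :=
  complex.Re `|x|.

Lemma ge0_ReK (R : rcfType) (z : R[i]) : 0 <= z -> (complex.Re z)%:C = z.
Proof. by rewrite lecE => /andP[/eqP /= h _]; case: z h => a b /= ->. Qed.

Section rnorm_theory.
Variables (R : realType) (V : normedModType R[i]).
Implicit Types x y : V.

Lemma rnormE x : (rnorm x)%:C = `|x|.
Proof. exact: ge0_ReK. Qed.

Lemma rnorm_ge0 x : 0 <= rnorm x.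
Proof. by rewrite -lecR rnormE normr_ge0. Qed.

Lemma rnormD x y : rnorm (x + y) <= rnorm x + rnorm y.
Proof. by rewrite -lecR rmorphD/= !rnormE ler_normD. Qed.

Lemma rnormN x : rnorm (- x) = rnorm x.
Proof. by rewrite /rnorm normrN. Qed.

Lemma rnorm_dist x y : rnorm (x - y) = rnorm (y - x).
Proof. by rewrite /rnorm distrC. Qed.

Lemma rnormZ (a : R[i]) x : rnorm (a *: x) = complex.Re `|a| * rnorm x.
Proof.
apply: (@complexI R); rewrite rmorphM/= ![(rnorm _)%:C]rnormE normrZ.
by congr (_ * _); apply/esym/ge0_ReK.
Qed.

Lemma rnorm0 : rnorm (0 : V) = 0. Proof. by rewrite /rnorm normr0. Qed.

Lemma rnorm_eq0 x : rnorm x = 0 -> x = 0.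
Proof. by move=> x0; apply/eqP; rewrite -normr_eq0 -rnormE x0. Qed.

Lemma rnorm_sum I (r : seq I) (P : pred I) (F : I -> V) :
  rnorm (\sum_(i <- r | P i) F i) <= \sum_(i <- r | P i) rnorm (F i).
Proof.
by rewrite -lecR rmorph_sum/= rnormE (le_trans (ler_norm_sum _ _ _))//
  ler_sum// => i _; rewrite rnormE.
Qed.

Lemma rnorm_ler_dist x y : `|rnorm x - rnorm y| <= rnorm (x - y).
Proof.
have h (u v : V) : rnorm u - rnorm v <= rnorm (u - v).
  by rewrite lerBlDr (le_trans _ (rnormD _ _))// subrK.
by rewrite ler_norml h andbT lerNl opprB rnorm_dist h.
Qed.

Lemma cvg_rnormP T (F : set_system T) (FF : Filter F) (f : T -> V) y :
  f @ F --> y <-> forall e : R, 0 < e -> \near F, rnorm (y - f F) < e.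
Proof.
split=> [/cvgrPdist_lt h e e0|h].
  have /h : 0 < e%:C by rewrite ltcR.
  by apply: filterS => t; rewrite -rnormE ltcR.
apply/cvgrPdist_lt => e; rewrite ltcE => /andP[/eqP/= ei e0].
apply: filterS (h _ e0) => t.
by rewrite -rnormE -ltcR; case: e ei {e0} => a b /= ->.
Qed.

Lemma cvg_rnorm T (F : set_system T) (FF : Filter F) (f : T -> V) y :
  f @ F --> y -> rnorm (f x) @[x --> F] --> rnorm y.
Proof.
move=> /cvg_rnormP h; apply/cvgrPdist_lt => e /h.
by apply: filterS => t; apply: le_lt_trans; exact: rnorm_ler_dist.
Qed.

Lemma cauchy_rnormP (F : set_system V) (FF : ProperFilter F) :
  cauchy F <-> forall e : R, 0 < e -> exists x, \near F, rnorm (x - F) < e.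
Proof.
split=> [/cauchyP h e e0|h].
  have /h[x hx] : 0 < e%:C by rewrite ltcR.
  exists x; apply: filterS hx => y.
  by rewrite -ball_normE/= -rnormE ltcR.
apply/cauchyP => e; rewrite ltcE => /andP[/eqP/= ei e0].
have [x hx] := h _ e0; exists x; apply: filterS hx => y.
by rewrite -ball_normE/= -rnormE -ltcR; case: e ei {e0} => a b /= ->.
Qed.

End rnorm_theory.

(* A countable orthonormal basis. The vectors are indexed by the subset onb_dom
   of nat, so that finite-dimensional spaces are included; onb_vec is irrelevant
   outside onb_dom. Every separable space has one: see separable_onb. *)
Record onb (R : realType) (H : innerType R) := Onb {
  onb_dom : pred nat;
  onb_vec :> nat -> H;
  onb_orthonormal : forall i j, onb_dom i -> onb_dom j ->
    inner (onb_vec i) (onb_vec j) = (i == j)%:R;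
  onb_dense : dense [set x : H | exists (n : nat) (c : nat -> R[i]),
    x = \sum_(0 <= k < n | onb_dom k) c k *: onb_vec k]
}.

Section inner_sums.
Variables (R : realType) (H : innerType R).
Implicit Types (x y z : H).

Lemma inner_sumZl I (r : seq I) (P : pred I) (a : I -> R[i]) (f : I -> H) z :
  inner (\sum_(i <- r | P i) a i *: f i) z = \sum_(i <- r | P i) a i * inner (f i) z.
Proof.
rewrite (linear_sumlz (innerdot H)); apply: eq_bigr => i _.
by rewrite (linearZl_LR (innerdot H)).
Qed.

Lemma inner_sumZr I (r : seq I) (P : pred I) (a : I -> R[i]) (f : I -> H) z :
  inner z (\sum_(i <- r | P i) a i *: f i) =
  \sum_(i <- r | P i) Num.conj (a i) * inner z (f i).
Proof.
rewrite (linear_sumr (innerdot H)); apply: eq_bigr => i _.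
by rewrite (linearZr_LR (innerdot H)).
Qed.

Section fixed.
Variables (D : pred nat) (e : nat -> H).
Hypothesis oe : forall i j, D i -> D j -> inner (e i) (e j) = (i == j)%:R.

Lemma inner_sum_orth n (a : nat -> R[i]) k : D k -> (k < n)%N ->
  inner (e k) (\sum_(0 <= j < n | D j) a j *: e j) = Num.conj (a k).
Proof.
move=> Dk kn; rewrite inner_sumZr big_mkcond (bigD1_seq k)/= ?iota_uniq//; last first.
  by rewrite mem_index_iota.
rewrite Dk oe// eqxx mulr1 big1 ?addr0// => j jk.
by case: ifPn => // Dj; rewrite oe// eq_sym (negbTE jk) mulr0.
Qed.

Lemma inner_sum_sum n (a b : nat -> R[i]) :
  inner (\sum_(0 <= k < n | D k) a k *: e k) (\sum_(0 <= k < n | D k) b k *: e k)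
  = \sum_(0 <= k < n | D k) a k * Num.conj (b k).
Proof.
rewrite inner_sumZl big_nat_cond [RHS]big_nat_cond.
by apply: eq_bigr => k /andP[/= kn Dk]; rewrite inner_sum_orth.
Qed.

Lemma rnorm_sum_orth n (a : nat -> R[i]) :
  rnorm (\sum_(0 <= k < n | D k) a k *: e k) ^+ 2 =
  \sum_(0 <= k < n | D k) (rnorm (a k : R[i]^o)) ^+ 2.
Proof.
apply: (@complexI R); rewrite rmorphXn/= rnormE sqr_normE inner_sum_sum rmorph_sum/=.
by apply: eq_bigr => k _; rewrite -normCK rmorphXn/= rnormE.
Qed.

Lemma bessel x n :
  \sum_(0 <= k < n | D k) (rnorm (inner x (e k) : R[i]^o)) ^+ 2 <= rnorm x ^+ 2.
Proof.
rewrite -rnorm_sum_orth; set p := \sum_(_ <= _ < _ | _) _.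
have px : inner x p = inner p p.
  rewrite inner_sum_sum inner_sumZr; apply: eq_bigr => k _.
  by rewrite mulrC.
have xp : inner (x - p) p = 0 by rewrite (linearBl (innerdot H))/= px subrr.
rewrite -lecR !rmorphXn/= !rnormE !sqr_normE -[in leRHS](subrK p x).
rewrite (hnormDd (form := innerdot H))//= lerDr.
exact: (dnorm_ge0 (innerdot H)).
Qed.

End fixed.
End inner_sums.

Definition separable_space (T : topologicalType) :=
  exists S : set T, countable S /\ dense S.

Section gram_schmidt.
Variables (R : realType) (H : innerType R) (d : nat -> H).

Let proj (s : seq H) (x : H) := x - \sum_(u <- s) inner x u *: u.
Let nz (x : H) := `|x|^-1 *: x.

Fixpoint gs_seq n : seq H :=
  if n is m.+1 then rcons (gs_seq m) (nz (proj (gs_seq m) (d m))) else [::].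

Let e n := nz (proj (gs_seq n) (d n)).

Let gsE n : gs_seq n = mkseq e n.
Proof. by elim: n => // n IH; rewrite /= mkseqS -IH. Qed.

Let eE n : e n = nz (d n - \sum_(0 <= k < n) inner (d n) (e k) *: e k).
Proof. by rewrite {1}/e /proj gsE /mkseq big_map /index_iota subn0. Qed.

Let nzz x : x != 0 -> inner (nz x) (nz x) = 1.
Proof.
move=> x0; rewrite /nz (dnormZ (innerdot H))/= -sqr_normE normfV normr_id.
by rewrite -exprMn mulVf ?expr1n// normr_eq0.
Qed.

Let nz0 x : (nz x == 0) = (x == 0).
Proof. by rewrite /nz scaler_eq0 invr_eq0 normr_eq0 orbb. Qed.

Let e1 n : e n != 0 -> inner (e n) (e n) = 1.
Proof. by rewrite /e nz0; exact: nzz. Qed.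

Let elt n k : (k < n)%N -> inner (e n) (e k) = 0.
Proof.
elim/ltn_ind: n k => n IH k kn.
rewrite eE; set w := _ - _.
suff wk : inner w (e k) = 0 by rewrite /nz (linearZl_LR (innerdot H))/= wk mulr0.
rewrite (linearBl (innerdot H))/= inner_sumZl (bigD1_seq k)/= ?iota_uniq ?mem_index_iota//.
rewrite big_nat_cond big1 ?addr0; last first.
  move=> j /andP[/= jn jk]; have [jk'|kj|jk'] := ltngtP j k.
  - by rewrite (innerC (e j)) IH// rmorph0 mulr0.
  - by rewrite IH// mulr0.
  - by rewrite jk' eqxx in jk.
have [->|/e1 ->] := eqVneq (e k) 0; last by rewrite mulr1 subrr.
by rewrite !(linear0r (innerdot H)) mulr0 subrr.
Qed.

Let eortho i j : e i != 0 -> e j != 0 -> inner (e i) (e j) = (i == j)%:R.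
Proof.
move=> i0 j0; have [ij|ji|->] := ltngtP i j; last exact: e1.
- by rewrite innerC elt// rmorph0.
- by rewrite elt.
Qed.

Let espan n : exists (c : nat -> R[i]), d n = \sum_(0 <= k < n.+1 | e k != 0) c k *: e k.
Proof.
set w := d n - \sum_(0 <= k < n) inner (d n) (e k) *: e k.
exists (fun k => if (k < n)%N then inner (d n) (e k) else `|w|).
rewrite big_mkcond/= big_nat_recr//= ltnn.
have -> : (if e n != 0 then `|w| *: e n else 0) = w.
  have -> : e n = nz w by rewrite eE.
  rewrite nz0; case: eqVneq => [->//|w0]/=.
  by rewrite /nz scalerA divff ?normr_eq0// scale1r.
rewrite addrC -[LHS](subrK (\sum_(0 <= k < n) inner (d n) (e k) *: e k)).
congr (_ + _); apply: eq_big_nat => k /= ->.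
by case: eqVneq => [->|//]; rewrite scaler0.
Qed.

Lemma gram_schmidt : dense (range d) -> inhabited (onb H).
Proof.
move=> dd; split; apply: (@Onb R H (fun n => e n != 0) e eortho).
move=> O O0 Oo; have [x [Ox [n _ dx]]] := dd O O0 Oo.
exists x; split => //; have [c dc] := espan n.
by exists n.+1, c; rewrite -dx.
Qed.

End gram_schmidt.

Lemma separable_onb (R : realType) (H : innerType R) :
  separable_space H -> inhabited (onb H).
Proof.
move=> [S [cS dS]].
have [S0|[f]] := pfcard_geP cS.
  have [] := dS setT; [by exists 0|exact: openT|by move=> x; rewrite S0 => -[]].
apply: (@gram_schmidt R H f) => O O0 Oo.
have [x [Ox Sx]] := dS O O0 Oo; exists x; split => //.
by have [n _ <-] := 'surj_f Sx; exists n.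
Qed.

Section hs_def.
Variables (R : realType) (H1 H2 : hilbertType R) (e : onb H2).

Definition antilinear (T : H2 -> H1) :=
  GRing.linear_for (Num.conj \; *:%R) T.

(* Continuity has to be required explicitly: an unbounded antilinear map may
   vanish on the basis e, in which case the sum would not see it. *)
Definition hs : {pred H2 -> H1} := mem [set T : H2 -> H1 | [/\ antilinear T, continuous T &
  (\sum_(0 <= k <oo | onb_dom e k) ((rnorm (T (e k))) ^+ 2)%:E < +oo)%E]].

(* The Hilbert space tensor product of H1 and H2, realized through the basis e
   of H2. *)
Record tensor := Tensor { tensor_fun :> H2 -> H1; _ : tensor_fun \in hs }.

HB.instance Definition _ := [isSub for tensor_fun].
HB.instance Definition _ := [Choice of tensor by <:].

Lemma hsP (T : H2 -> H1) : T \in hs <-> [/\ antilinear T, continuous T &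
  (\sum_(0 <= k <oo | onb_dom e k) ((rnorm (T (e k))) ^+ 2)%:E < +oo)%E].
Proof. by split=> [/set_mem|/mem_set]. Qed.

Lemma antilinearP (T : H2 -> H1) : antilinear T ->
  [/\ T 0 = 0, forall x y, T (x + y) = T x + T y,
      forall x y, T (x - y) = T x - T y & forall a x, T (a *: x) = Num.conj a *: T x].
Proof.
move=> aT.
have TD x y : T (x + y) = T x + T y.
  by have := aT 1 x y; rewrite /= rmorph1 !scale1r.
have T0 : T 0 = 0 by apply: (addrI (T 0)); rewrite -TD !addr0.
have TZ a x : T (a *: x) = Num.conj a *: T x.
  by have := aT a x 0; rewrite /= T0 !addr0.
split => // x y; rewrite TD; congr (_ + _).
by rewrite -scaleN1r TZ rmorphN rmorph1 scaleN1r.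
Qed.

Definition psum (T : H2 -> H1) n : R :=
  \sum_(0 <= k < n | onb_dom e k) (rnorm (T (e k))) ^+ 2.

Lemma psum_nd T : {homo psum T : n m / (n <= m)%N >-> n <= m}.
Proof.
move=> n m nm; rewrite /psum [leRHS](big_cat_nat _ nm)//= lerDl sumr_ge0// => i _.
exact: sqr_ge0.
Qed.

Lemma psum_ge0 T n : 0 <= psum T n.
Proof. by apply: sumr_ge0 => i _; exact: sqr_ge0. Qed.

Lemma summableP T :
  (\sum_(0 <= k <oo | onb_dom e k) ((rnorm (T (e k))) ^+ 2)%:E < +oo)%E <->
  exists M, forall n, psum T n <= M.
Proof.
have ge0 n : (0 <= n)%N -> onb_dom e n -> (0 <= ((rnorm (T (e n))) ^+ 2)%:E)%E.
  by move=> _ _; rewrite lee_fin sqr_ge0.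
split=> [h|[M hM]].
  have h0 : (0 <= \sum_(0 <= k <oo | onb_dom e k) ((rnorm (T (e k))) ^+ 2)%:E)%E.
    by apply: nneseries_ge0 => n; exact: ge0.
  exists (fine (\sum_(0 <= k <oo | onb_dom e k) ((rnorm (T (e k))) ^+ 2)%:E)%E) => n.
  rewrite -lee_fin fineK ?ge0_fin_numE// /psum -sumEFin.
  exact: nneseries_lim_ge.
apply: (@le_lt_trans _ _ M%:E); last exact: ltry.
apply: lime_le; first by apply: is_cvg_nneseries => n; exact: ge0.
by apply: nearW => n; rewrite sumEFin lee_fin; exact: hM.
Qed.

Lemma psumD T S n : psum (T \+ S) n <= 2 * psum T n + 2 * psum S n.
Proof.
rewrite /psum !mulr_sumr -big_split/=; apply: ler_sum => k _.
have := rnormD (T (e k)) (S (e k)); have := rnorm_ge0 (T (e k) + S (e k)).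
set a := rnorm _; set b := rnorm _; set c := rnorm _ => a0 abc.
apply: (@le_trans _ _ ((b + c) ^+ 2)); first by rewrite ler_sqr ?nnegrE// (le_trans a0).
by have := sqr_ge0 (b - c); lra.
Qed.

Lemma psumZ a T n : psum (a \*: T) n = complex.Re `|a| ^+ 2 * psum T n.
Proof.
by rewrite /psum mulr_sumr; apply: eq_bigr => k _; rewrite rnormZ exprMn.
Qed.

Lemma hs_submod : GRing.submod_closed hs.
Proof.
split.
  apply/hsP; split => [a x y|x|].
  - by rewrite /= scaler0 addr0.
  - exact: cvg_cst.
  - apply/summableP; exists 0 => n; rewrite /psum big1// => k _.
    by rewrite rnorm0 expr0n.
move=> a T S /hsP[aT cT /summableP[M hM]] /hsP[aS cS /summableP[N hN]].
apply/hsP; split.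
- move=> b x y; rewrite !fctE/= aT aS/=.
  by rewrite !scalerDr addrACA !scalerA mulrC.
- by move=> x; apply: cvgD; [apply: cvgZl_tmp; exact: cT|exact: cS].
- apply/summableP; exists (2 * (complex.Re `|a| ^+ 2 * M) + 2 * N) => n.
  apply: le_trans (psumD _ _ _) _; rewrite psumZ.
  by rewrite lerD// ler_wpM2l// ler_wpM2l// sqr_ge0.
Qed.

HB.instance Definition _ := GRing.isSubmodClosed.Build _ _ hs hs_submod.
HB.instance Definition _ := [SubChoice_isSubLmodule of tensor by <:].

End hs_def.

Section complex_cvg.
Variable R : realType.

Lemma rnorm_le_ReIm (z : R[i]) :
  rnorm (z : R[i]^o) <= `|complex.Re z| + `|complex.Im z|.
Proof.
case: z => a b; rewrite /rnorm normc_def/=.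
rewrite -(@ler_pXn2r _ 2) ?nnegrE ?sqrtr_ge0 ?addr_ge0//.
rewrite sqr_sqrtr ?addr_ge0 ?sqr_ge0// sqrrD !real_normK ?num_real//.
by rewrite addrAC lerDl mulrn_wge0// mulr_ge0.
Qed.

Lemma Re_le_rnorm (z : R[i]) : `|complex.Re z| <= rnorm (z : R[i]^o).
Proof.
case: z => a b; rewrite /rnorm normc_def/= -sqrtr_sqr ler_wsqrtr//.
by rewrite lerDl sqr_ge0.
Qed.

Lemma Im_le_rnorm (z : R[i]) : `|complex.Im z| <= rnorm (z : R[i]^o).
Proof.
case: z => a b; rewrite /rnorm normc_def/= -sqrtr_sqr ler_wsqrtr//.
by rewrite lerDr sqr_ge0.
Qed.

Lemma Re_sum I (r : seq I) (P : pred I) (f : I -> R[i]) :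
  complex.Re (\sum_(i <- r | P i) f i) = \sum_(i <- r | P i) complex.Re (f i).
Proof. by apply: (big_morph (@complex.Re R)) => // -[? ?] []. Qed.

Lemma Im_sum I (r : seq I) (P : pred I) (f : I -> R[i]) :
  complex.Im (\sum_(i <- r | P i) f i) = \sum_(i <- r | P i) complex.Im (f i).
Proof. by apply: (big_morph (@complex.Im R)) => // -[? ?] []. Qed.

Lemma cvg_complex T (F : set_system T) (FF : Filter F) (u : T -> R[i]) (a b : R) :
  complex.Re (u x) @[x --> F] --> a -> complex.Im (u x) @[x --> F] --> b ->
  (u : T -> R[i]^o) @ F --> (a +i* b : R[i]^o).
Proof.
move=> /cvgrPdist_lt ha /cvgrPdist_lt hb; apply/cvg_rnormP => e e0.
have e20 : 0 < e / 2 by rewrite divr_gt0.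
near=> x; apply: le_lt_trans (rnorm_le_ReIm _) _.
rewrite [ltRHS]splitr ltrD//.
  rewrite (_ : complex.Re _ = a - complex.Re (u x)); last by case: (u x).
  by near: x; exact: ha.
rewrite (_ : complex.Im _ = b - complex.Im (u x)); last by case: (u x).
by near: x; exact: hb.
Unshelve. all: by end_near. Qed.

Lemma cvg_conj T (F : set_system T) (FF : Filter F) (u : T -> R[i]^o) (l : R[i]^o) :
  u @ F --> l -> ((Num.conj (u x) : R[i]^o) @[x --> F] --> (Num.conj l : R[i]^o)).
Proof.
move=> /cvg_rnormP h; apply/cvg_rnormP => e /h; apply: filterS => x.
by rewrite /rnorm -rmorphB norm_conjC.
Qed.

Lemma sum_sqr_le I (r : seq I) (P : pred I) (a b : I -> R) :
  (\sum_(i <- r | P i) a i * b i) ^+ 2 <=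
  (\sum_(i <- r | P i) a i ^+ 2) * (\sum_(i <- r | P i) b i ^+ 2).
Proof.
suff [] : [/\ (\sum_(i <- r | P i) a i * b i) ^+ 2 <=
  (\sum_(i <- r | P i) a i ^+ 2) * (\sum_(i <- r | P i) b i ^+ 2),
  0 <= \sum_(i <- r | P i) a i ^+ 2 & 0 <= \sum_(i <- r | P i) b i ^+ 2] by [].
elim/big_rec3 : _ => [|i x y z _ [h x0 y0]]; first by rewrite expr0n mulr0.
move: (a i) (b i) => s t.
have s0 := sqr_ge0 s; have t0 := sqr_ge0 t.
split; [|exact: addr_ge0|exact: addr_ge0].
have k : 2 * (z * (s * t)) <= y * t ^+ 2 + x * s ^+ 2.
  apply: le_trans (ler_norm _) _.
  rewrite -(@ler_pXn2r _ 2) ?nnegrE//; last by apply: addr_ge0; exact: mulr_ge0.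
  rewrite real_normK ?num_real//.
  have := sqr_ge0 (y * t ^+ 2 - x * s ^+ 2).
  have : z ^+ 2 * (s * t) ^+ 2 <= y * x * (s * t) ^+ 2.
    by rewrite ler_wpM2r// ?sqr_ge0.
  nra.
have -> : (s * t + z) ^+ 2 = (s * t) ^+ 2 + 2 * (z * (s * t)) + z ^+ 2 by ring.
have -> : (s ^+ 2 + y) * (t ^+ 2 + x) = (s * t) ^+ 2 + (y * t ^+ 2 + x * s ^+ 2) + y * x.
  by ring.
by rewrite !lerD.
Qed.

End complex_cvg.

Section hs_theory.
Variables (R : realType) (H1 H2 : hilbertType R) (e : onb H2).
Implicit Types (T S : H2 -> H1).

Lemma hs_bound T M x : antilinear T -> continuous T ->
  (forall n, psum e T n <= M) -> rnorm (T x) ^+ 2 <= M * rnorm x ^+ 2.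
Proof.
move=> aT cT hM; rewrite leNgt; apply/negP => xM.
pose g (y : H2) : R := rnorm (T y) ^+ 2 - M * rnorm y ^+ 2.
have cg : continuous g.
  move=> y; apply: cvgB.
    by rewrite /= !expr2; apply: cvgM; apply: cvg_rnorm; exact: cT.
  apply: cvgM; first exact: cvg_cst.
  by rewrite /= !expr2; apply: cvgM; apply: cvg_rnorm; exact: cvg_id.
have [//||y [gy [n [c yE]]]] := @onb_dense _ _ e (g @^-1` [set r | 0 < r]).
  by exists x; rewrite /= /g subr_gt0.
  apply: open_comp; last exact: open_gt.
  by move=> y _; exact: cg.
move: gy; rewrite /= /g subr_gt0 ltNge => /negP; apply.
have [T0 TD _ TZ] := antilinearP aT.
rewrite yE rnorm_sum_orth; last exact: onb_orthonormal.
have -> : T (\sum_(0 <= k < n | onb_dom e k) c k *: e k) =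
    \sum_(0 <= k < n | onb_dom e k) Num.conj (c k) *: T (e k).
  by rewrite (big_morph T TD T0); apply: eq_bigr => k _; rewrite TZ.
apply: (@le_trans _ _ ((\sum_(0 <= k < n | onb_dom e k)
    rnorm (c k : R[i]^o) * rnorm (T (e k))) ^+ 2)).
  rewrite ler_sqr ?nnegrE ?rnorm_ge0//; last first.
    by apply: sumr_ge0 => k _; rewrite mulr_ge0 ?rnorm_ge0.
  apply: le_trans (rnorm_sum _ _ _) _; apply: ler_sum => k _.
  by rewrite rnormZ norm_conjC.
apply: le_trans (sum_sqr_le _ _ _ _) _.
rewrite mulrC ler_wpM2r//; last exact: hM.
by apply: sumr_ge0 => k _; exact: sqr_ge0.
Qed.

Lemma bounded_antilinear_continuous T C : antilinear T ->
  (forall x, rnorm (T x) <= C * rnorm x) -> continuous T.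
Proof.
move=> /antilinearP[_ _ TB _] hC x; apply/cvg_rnormP => r r0.
have C0 : 0 < `|C| + 1 by rewrite ltr_wpDl.
have : (id : H2 -> H2) @ x --> x by exact: cvg_id.
move=> /cvg_rnormP /(_ (r / (`|C| + 1)) (divr_gt0 r0 C0)).
apply: filterS => y; rewrite ltr_pdivlMr// -TB; apply: le_lt_trans.
apply: le_trans (hC _) _; rewrite mulrC ler_wpM2l ?rnorm_ge0//.
by rewrite (le_trans (ler_norm _))// lerDl.
Qed.

(* The sum of the series, in R[i]. *)
Definition hs_inner T S : R[i] :=
  limn (fun n => \sum_(0 <= k < n | onb_dom e k) inner (T (e k)) (S (e k)) : R[i]^o).

Let real_cvg (w : nat -> R) M :
  (forall n, \sum_(0 <= k < n | onb_dom e k) `|w k| <= M) ->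
  cvgn (fun n => \sum_(0 <= k < n | onb_dom e k) w k).
Proof.
move=> hM; pose v k := if onb_dom e k then w k else 0.
rewrite (_ : (fun n => _) = series v); last first.
  by apply/funext => n; rewrite /series/= big_mkcond.
apply: normed_cvg; apply: nondecreasing_is_cvgn.
  move=> n m nm; rewrite /series/= [leRHS](big_cat_nat _ nm)//= lerDl.
  by apply: sumr_ge0.
exists M => _ [n _ <-]; apply: le_trans (hM n).
rewrite /series/= [leRHS]big_mkcond/= ler_sum// => k _; rewrite /v.
by case: ifPn => // _; rewrite normr0.
Qed.

Let le_rnorm_sum T S M N n : (forall n, psum e T n <= M) ->
  (forall n, psum e S n <= N) ->
  \sum_(0 <= k < n | onb_dom e k) rnorm (inner (T (e k)) (S (e k)) : R[i]^o) <= M + N.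
Proof.
move=> hM hN; apply: le_trans (lerD (hM n) (hN n)).
rewrite /psum -big_split/=; apply: ler_sum => k _.
apply: (@le_trans _ _ (rnorm (T (e k)) * rnorm (S (e k)))).
  rewrite -lecR rmorphM/= !rnormE; exact: inner_le.
move: (rnorm_ge0 (T (e k))) (rnorm_ge0 (S (e k))).
by move: (rnorm _) (rnorm _) => s t s0 t0; have := sqr_ge0 (s - t); nra.
Qed.

Lemma hs_inner_cvg T S : T \in hs e -> S \in hs e ->
  (fun n => \sum_(0 <= k < n | onb_dom e k) inner (T (e k)) (S (e k)) : R[i]^o)
    @ \oo --> (hs_inner T S : R[i]^o).
Proof.
move=> /hsP[_ _ /summableP[M hM]] /hsP[_ _ /summableP[N hN]].
suff : cvgn (fun n => \sum_(0 <= k < n | onb_dom e k) inner (T (e k)) (S (e k)) : R[i]^o).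
  by [].
have h1 := @real_cvg (fun k => complex.Re (inner (T (e k)) (S (e k)))) (M + N).
have h2 := @real_cvg (fun k => complex.Im (inner (T (e k)) (S (e k)))) (M + N).
have {}/h1 /cvg_ex[a ha] n :
    \sum_(0 <= k < n | onb_dom e k) `|complex.Re (inner (T (e k)) (S (e k)))| <= M + N.
  apply: le_trans (le_rnorm_sum n hM hN); apply: ler_sum => k _; exact: Re_le_rnorm.
have {}/h2 /cvg_ex[b hb] n :
    \sum_(0 <= k < n | onb_dom e k) `|complex.Im (inner (T (e k)) (S (e k)))| <= M + N.
  apply: le_trans (le_rnorm_sum n hM hN); apply: ler_sum => k _; exact: Im_le_rnorm.
apply/cvg_ex; exists (a +i* b); apply: cvg_complex.
  by under eq_cvg do rewrite Re_sum.
by under eq_cvg do rewrite Im_sum.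
Qed.

Lemma psum_cvg T : T \in hs e -> cvgn (psum e T).
Proof.
move=> /hsP[_ _ /summableP[M hM]]; apply: nondecreasing_is_cvgn.
  exact: psum_nd.
by exists M => _ [n _ <-].
Qed.

Lemma hs_innerE T : T \in hs e -> hs_inner T T = (limn (psum e T))%:C.
Proof.
move=> hT; apply: (@cvg_lim R[i]^o) => //.
have E n : \sum_(0 <= k < n | onb_dom e k) inner (T (e k)) (T (e k)) = (psum e T n)%:C.
  by rewrite rmorph_sum/=; apply: eq_bigr => k _; rewrite -sqr_normE -rnormE rmorphXn.
apply: cvg_complex; under eq_cvg do rewrite E.
  exact: psum_cvg.
exact: cvg_cst.
Qed.

End hs_theory.

Section hs_hilbert.
Variables (R : realType) (H1 H2 : hilbertType R) (e : onb H2).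
Local Notation HS := (tensor H1 e).

Lemma tensor_funP (T : HS) : (T : H2 -> H1) \in hs e.
Proof. by case: T. Qed.

Definition tensor_inner (T S : HS) : R[i] := hs_inner e T S.

Let inner_scalar' (S : HS) : scalar (tensor_inner ^~ S).
Proof.
move=> a T U; apply: (@cvg_lim R[i]^o) => //.
under eq_cvg => n.
  under eq_bigr => k _ do rewrite /= inner_scalar.
  rewrite big_split/= -mulr_sumr.
  over.
apply: cvgD; last by apply: hs_inner_cvg; exact: tensor_funP.
by apply: (@cvgZl_tmp _ R[i]^o); apply: hs_inner_cvg; exact: tensor_funP.
Qed.

Let innerC' (T S : HS) : tensor_inner T S = Num.conj (tensor_inner S T).
Proof.
apply: (@cvg_lim R[i]^o) => //.
under eq_cvg => n.
  under eq_bigr => k _ do rewrite innerC.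
  rewrite -rmorph_sum.
  over.
by apply: cvg_conj; apply: hs_inner_cvg; exact: tensor_funP.
Qed.

Let inner_gt0' (T : HS) : T != 0 -> 0 < tensor_inner T T.
Proof.
have hT := tensor_funP T.
move=> T0; rewrite /tensor_inner hs_innerE// ltcR.
have h n : psum e T n <= limn (psum e T).
  by apply: nondecreasing_cvgn_le; [exact: psum_nd|exact: psum_cvg].
rewrite lt_neqAle (le_trans (psum_ge0 e T 0) (h 0%N)) andbT.
apply: contra T0 => /eqP l0; apply/eqP/val_inj/funext => x /=.
have /hsP[aT cT _] := hT.
have := hs_bound x aT cT h; rewrite -l0 mul0r => Tx.
apply: rnorm_eq0; apply/eqP; rewrite -sqrf_eq0 eq_le Tx/=.
exact: sqr_ge0.
Qed.

HB.instance Definition _ :=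
  Lmodule_isInner.Build R HS inner_scalar' innerC' inner_gt0'.

Lemma tensor_rnorm (T : HS) : rnorm T ^+ 2 = limn (psum e T).
Proof.
apply: (@complexI R); rewrite rmorphXn/= rnormE sqr_normE.
by rewrite -hs_innerE// tensor_funP.
Qed.

Lemma psum_le_rnorm (T : HS) n : psum e T n <= rnorm T ^+ 2.
Proof.
rewrite tensor_rnorm; apply: nondecreasing_cvgn_le; first exact: psum_nd.
exact/psum_cvg/tensor_funP.
Qed.

Lemma rnorm_le_psum (T : HS) M : 0 <= M -> (forall n, psum e T n <= M ^+ 2) ->
  rnorm T <= M.
Proof.
move=> M0 hM; rewrite -(@ler_pXn2r _ 2) ?nnegrE ?rnorm_ge0// tensor_rnorm.
by apply: limr_le; [exact/psum_cvg/tensor_funP|exact: nearW].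
Qed.

Lemma tensor_apply_le (T : HS) x : rnorm (T x) <= rnorm T * rnorm x.
Proof.
have /hsP[aT cT _] := tensor_funP T.
rewrite -(@ler_pXn2r _ 2) ?nnegrE ?mulr_ge0 ?rnorm_ge0// exprMn.
by apply: hs_bound => //; exact: psum_le_rnorm.
Qed.

Let complete' (F : set_system HS) : ProperFilter F -> cauchy F -> cvg F.
Proof.
move=> FF /cauchy_rnormP cF.
have cvgx x : exists l : H1, (fun T : HS => T x) @ F --> l.
  suff : cvg ((fun T : HS => T x) @ F) by move=> /cvg_ex[l xl]; exists l.
  apply: cauchy_cvg; apply/cauchy_rnormP => r r0.
  have x0 : 0 < rnorm x + 1 by rewrite ltr_wpDl// rnorm_ge0.
  have [T hT] := cF _ (divr_gt0 r0 x0).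
  exists (T x); apply: filterS hT => S; rewrite ltr_pdivlMr//; apply: le_lt_trans.
  apply: le_trans (tensor_apply_le (T - S) x) _.
  by rewrite ler_wpM2l ?rnorm_ge0// lerDl.
have [L hL] := choice cvgx.
have aL : antilinear L.
  move=> a x y.
  have h : (fun T : HS => T (a *: x + y)) @ F --> Num.conj a *: L x + L y.
    have -> : (fun T : HS => T (a *: x + y)) = (fun T : HS => Num.conj a *: T x + T y).
      by apply/funext => T; have /hsP[aT _ _] := tensor_funP T; rewrite aT.
    by apply: cvgD; [apply: cvgZl_tmp; exact: hL|exact: hL].
  exact: (cvg_unique (@norm_hausdorff _ H1) (hL (a *: x + y)) h).
have key (T : HS) r : 0 < r -> (\near F, rnorm (T - F) < r) ->
    (T : H2 -> H1) - L \in hs e /\ forall n, psum e ((T : H2 -> H1) - L) n <= r ^+ 2.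
  move=> r0 hT.
  have /hsP[aT cT _] := tensor_funP T.
  have aTL : antilinear ((T : H2 -> H1) - L).
    move=> a x y; rewrite !fctE/= aT aL/= opprD addrACA scalerBr.
    by [].
  have hn n : psum e ((T : H2 -> H1) - L) n <= r ^+ 2.
    apply: (@cvgr_to_le _ F _ _ (fun S : HS => psum e (T - S) n)).
      apply: cvg_big => [|k _]; first exact: add_continuous.
      rewrite /= !expr2; apply: cvgM; apply: cvg_rnorm; apply: cvgB => //;
        exact: cvg_cst.
    apply: filterS hT => S hS; apply: le_trans (psum_le_rnorm _ _) _.
    by rewrite ler_sqr ?nnegrE ?rnorm_ge0 ?ltW.
  split => //; apply/hsP; split => //; last by apply/summableP; exists (r ^+ 2).
  apply: (@bounded_antilinear_continuous _ _ _ _ r) => // x.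
  apply: (@cvgr_to_le _ F _ _ (fun S : HS => rnorm ((T - S) x))).
    have h : (fun S : HS => T x - S x) @ F --> T x - L x.
      by apply: cvgB; [exact: cvg_cst|exact: hL].
    exact: cvg_rnorm h.
  apply: filterS hT => S hS; apply: le_trans (tensor_apply_le _ _) _.
  by rewrite ler_wpM2r ?rnorm_ge0// ltW.
have hsL : L \in hs e.
  have [T hT] := cF _ ltr01.
  have [TL _] := key T 1 ltr01 hT.
  have -> : L = (T : H2 -> H1) - ((T : H2 -> H1) - L) by rewrite opprB addrC subrK.
  by apply: rpredB => //; exact: tensor_funP.
apply/cvg_ex; exists (Tensor hsL); apply/cvg_rnormP => r r0.
have r20 : 0 < r / 2 by rewrite divr_gt0.
have [T hT] := cF _ r20; have [TL hn] := key T _ r20 hT.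
have TLr : rnorm (T - Tensor hsL) <= r / 2 by apply: rnorm_le_psum => //; exact: ltW.
apply: filterS hT => S hS.
have -> : Tensor hsL - S = (T - S) - (T - Tensor hsL) by rewrite opprB [RHS]addrC subrKA.
apply: le_lt_trans (rnormD _ _) _; rewrite rnormN [ltRHS]splitr.
exact: ltr_leD.
Qed.

HB.instance Definition _ := Uniform_isComplete.Build HS complete'.

End hs_hilbert.

Section elementary_tensor.
Variables (R : realType) (H1 H2 : hilbertType R) (e : onb H2).

Lemma hs_elementary (f : H1) (g : H2) : (fun t => inner g t *: f) \in hs e.
Proof.
apply/hsP.
have aT : antilinear (fun t => inner g t *: f).
  move=> a x y /=; rewrite (linearDr (innerdot H2)) (linearZr_LR (innerdot H2))/=.
  by rewrite scalerDl scalerA.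
split => //.
- apply: (@bounded_antilinear_continuous _ _ _ _ (rnorm g * rnorm f)) => // x.
  rewrite rnormZ mulrAC ler_wpM2r ?rnorm_ge0//.
  by rewrite -lecR rmorphM/= ge0_ReK// !rnormE inner_le.
- apply/(summableP e (fun t => inner g t *: f)); exists (rnorm g ^+ 2 * rnorm f ^+ 2) => n.
  apply: (@le_trans _ _ ((\sum_(0 <= k < n | onb_dom e k)
      rnorm (inner g (e k) : R[i]^o) ^+ 2) * rnorm f ^+ 2)); last first.
    by rewrite ler_wpM2r ?sqr_ge0// bessel//; exact: onb_orthonormal.
  by rewrite mulr_suml; apply: ler_sum => k _; rewrite rnormZ exprMn.
Qed.

Definition elementary_tensor (f : H1) (g : H2) : tensor H1 e :=
  Tensor (hs_elementary f g).

End elementary_tensor.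

Section frames.
Variables (R : realType) (d : measure_display) (Y : measurableType d).
Variables (nu : {measure set Y -> \bar R}) (K : hilbertType R).

(* Complex functions are measurable with respect to the Borel sets of R[i]. *)
Definition continuous_frame (Phi : Y -> K) : Prop :=
  (forall f : K, measurable_fun setT
     (fun y => inner f (Phi y) : g_sigma_algebraType (@open R[i]^o))) /\
  (exists A B : R, [/\ 0 < A, A <= B & forall f : K,
     ((A * rnorm f ^+ 2)%:E
        <= \int[nu]_y (rnorm (inner f (Phi y) : R[i]^o) ^+ 2)%:E
        <= (B * rnorm f ^+ 2)%:E)%E]).

Definition phase_retrieval (Phi : Y -> K) : Prop :=
  forall f g : K,
    {ae nu, forall y, `|inner f (Phi y)| = `|inner g (Phi y)|} ->
    exists theta : R, f = (cos theta +i* sin theta) *: g.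

Definition phase_retrieval_frame (Phi : Y -> K) : Prop :=
  continuous_frame Phi /\ phase_retrieval Phi.

End frames.

Definition tensor_map (R : realType) (H1 H2 : hilbertType R) (e : onb H2)
    (X1 X2 : Type) (F1 : X1 -> H1) (F2 : X2 -> H2) : X1 * X2 -> tensor H1 e :=
  fun x => elementary_tensor e (F1 x.1) (F2 x.2).

(* Main.v *)
Require Import Defs.
From mathcomp Require Import all_boot all_order all_algebra.
From mathcomp Require Import all_classical all_reals all_analysis.
From mathcomp Require Import measurable_realfun.
From mathcomp Require Import complex.
From mathcomp Require Import ring.
Import Order.TTheory GRing.Theory Num.Theory.
Import numFieldNormedType.Exports.
Local Open Scope classical_set_scope.
Local Open Scope ring_scope.
Local Open Scope complex_scope.
Set Implicit Arguments. Unset Strict Implicit. Unset Printing Implicit Defensive.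

(** Everything rests on the identity <T, f (x) g> = <T g, f> for T in the
    tensor product ([inner_elementary]), which turns the frame coefficients of
    T at (x1, x2) into <T (F2 x2), F1 x1>.  For fixed f = F1 x1 this is a
    bounded antilinear functional of g = F2 x2, hence equals <w(x1), F2 x2> for
    a vector w(x1) of H2 ([riesz]).  A statement about the product frame thus
    becomes, on almost every slice, a statement about F2 and the vector w(x1),
    whose coordinates <w(x1), e_k> = <T e_k, F1 x1> are coefficients of F1.

    From the factors to the product.  By Tonelli the energy of T is the
    integral over x1 of the F2-energy of w(x1), which is comparable to
    |w(x1)|^2 = sum_k |<T e_k, F1 x1>|^2.  Integrating term by term and using
    the bounds of F1 gives something comparable to sum_k |T e_k|^2 = |T|^2
    ([frame_bounds_tensor]).  If T and S have coefficients of equal modulus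
    almost everywhere, phase retrieval for F2 on almost every slice shows that
    w_T(x1) and w_S(x1) agree up to a phase, so |<T u, F1 x1>| = |<S u, F1 x1>|
    for every u in H2; phase retrieval for F1 then yields T u = c(u) S u with
    |c(u)| = 1.  Linear algebra makes c independent of u ([phase_uniform]).

    From the product to the factors.  On f (x) g the coefficients factor as
    <g, F2 x2> <f, F1 x1> and the energy is the product of the two energies
    ([frame_energy_elementary]).  Fixing one of the two vectors, or one of the
    two points, transfers measurability, the frame bounds and phase retrieval
    to the remaining factor.  The bounds need care because an energy may a
    priori be 0 or infinite; the two-sided estimate excludes both
    ([frame_bounds_cofactor]). *)

Lemma cvg_eqfun T U (F : set_system T) (f g : T -> U) (l : set_system U) :
  f =1 g -> f @ F --> l -> g @ F --> l.
Proof. by move=> fg; rewrite (eq_cvg F l fg). Qed.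

(** * Norms, limits and expansions in an orthonormal basis *)

Section norm_facts.
Variables (R : realType) (H : innerType R).
Implicit Types x y : H.

Lemma rnorm_gt0 x : x != 0 -> 0 < rnorm x.
Proof.
move=> x0; rewrite lt_neqAle rnorm_ge0 andbT eq_sym.
by apply: contra x0 => /eqP/rnorm_eq0 ->.
Qed.

Lemma rnorm_inner_le x y : rnorm (inner x y : R[i]^o) <= rnorm x * rnorm y.
Proof. by rewrite -lecR rmorphM/= !rnormE; exact: inner_le. Qed.

Lemma rnorm_inner_self x : rnorm (inner x x : R[i]^o) = rnorm x ^+ 2.
Proof.
apply: (@complexI R); rewrite [LHS]rnormE rmorphXn/= rnormE -sqr_normE.
by rewrite normrX normr_id.
Qed.

Lemma rnorm_scalarM (a b : R[i]) :
  rnorm (a * b : R[i]^o) = rnorm (a : R[i]^o) * rnorm (b : R[i]^o).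
Proof. exact: (@rnormZ _ R[i]^o a b). Qed.

Lemma inner_cvgl T (F : set_system T) {FF : Filter F} (u : T -> H) (l x : H) :
  u @ F --> l -> ((inner (u t) x : R[i]^o) @[t --> F] --> (inner l x : R[i]^o)).
Proof.
move=> /cvg_rnormP ul; apply/cvg_rnormP => r r0.
have x0 : 0 < rnorm x + 1 by rewrite ltr_wpDl// rnorm_ge0.
apply: filterS (ul _ (divr_gt0 r0 x0)) => t; rewrite ltr_pdivlMr//.
apply: le_lt_trans.
have -> : inner l x - inner (u t) x = inner (l - u t) x.
  by rewrite (linearBl (innerdot H)).
apply: (le_trans (rnorm_inner_le _ _)).
by rewrite ler_wpM2l ?rnorm_ge0// lerDl.
Qed.

End norm_facts.

Section elementary_tensor_norm.
Variables (R : realType) (H1 H2 : hilbertType R) (e : onb H2).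
Implicit Types (f : H1) (g : H2).

Lemma psum_elementary f g n : psum e (elementary_tensor e f g) n =
  (\sum_(0 <= k < n | onb_dom e k) rnorm (inner g (e k) : R[i]^o) ^+ 2)
    * rnorm f ^+ 2.
Proof.
by rewrite /psum mulr_suml; apply: eq_bigr => k _; rewrite rnormZ exprMn.
Qed.

(** The upper bound is Bessel's inequality for g.  The lower bound comes from
    the operator norm being at most the Hilbert-Schmidt norm, so Parseval's
    identity is not presupposed; it is a consequence, see [parseval]. *)
Lemma rnorm_elementary f g :
  rnorm (elementary_tensor e f g) = rnorm f * rnorm g.
Proof.
apply/eqP; rewrite eq_le; apply/andP; split.
  apply: rnorm_le_psum => [|n]; first by rewrite mulr_ge0 ?rnorm_ge0.
  rewrite psum_elementary exprMn mulrC ler_wpM2l ?sqr_ge0//.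
  by apply: bessel; exact: onb_orthonormal.
have [->|g0] := eqVneq g 0; first by rewrite rnorm0 mulr0 rnorm_ge0.
(* Evaluating f (x) g at g itself gives |g|^2 f. *)
have := tensor_apply_le (elementary_tensor e f g) g.
rewrite /= rnormZ.
rewrite [X in X * _](rnorm_inner_self g) expr2 mulrAC ler_pM2r ?rnorm_gt0//.
by rewrite mulrC.
Qed.

End elementary_tensor_norm.

Section parseval.
Variables (R : realType) (H : hilbertType R) (e : onb H).

(** The Hilbert-Schmidt norm of g (x) g is both |g|^2 and, computed in the
    basis e, |g| times the square root of the sum below. *)
Lemma parseval (g : H) :
  (fun n => \sum_(0 <= k < n | onb_dom e k) rnorm (inner g (e k) : R[i]^o) ^+ 2)
    @ \oo --> rnorm g ^+ 2.
Proof.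
have [->|g0] := eqVneq g 0.
  rewrite rnorm0 expr0n/= (_ : (fun n => _) = fun=> 0); first exact: cvg_cst.
  apply/funext => n; rewrite big1// => k _.
  by rewrite (linear0l (innerdot H)) rnorm0 expr0n.
have g2 : rnorm g ^+ 2 != 0.
  by rewrite sqrf_eq0 gt_eqF ?rnorm_gt0.
pose T := elementary_tensor e g g.
have hT : psum e T @ \oo --> rnorm g ^+ 2 * rnorm g ^+ 2.
  rewrite -exprMn -(rnorm_elementary e) tensor_rnorm.
  exact: psum_cvg (tensor_funP T).
rewrite -[X in _ --> X](mulfK g2).
apply: (@cvg_eqfun _ _ _ (fun n => psum e T n * (rnorm g ^+ 2)^-1)).
  by move=> n /=; rewrite psum_elementary mulfK.
by apply: cvgM => //; exact: cvg_cst.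
Qed.

Lemma onb_expansion (g : H) :
  (fun n => \sum_(0 <= k < n | onb_dom e k) inner g (e k) *: e k) @ \oo --> g.
Proof.
have oe := @onb_orthonormal _ _ e.
pose p n := \sum_(0 <= k < n | onb_dom e k) inner g (e k) *: e k.
have pE n : rnorm (g - p n) ^+ 2 = rnorm g ^+ 2 -
    \sum_(0 <= k < n | onb_dom e k) rnorm (inner g (e k) : R[i]^o) ^+ 2.
  have gp : inner g (p n) = inner (p n) (p n).
    by rewrite inner_sum_sum// inner_sumZr; apply: eq_bigr => k _; rewrite mulrC.
  have o : inner (g - p n) (p n) = 0 by rewrite (linearBl (innerdot H))/= gp subrr.
  rewrite -(rnorm_sum_orth oe) -/(p n).
  apply/eqP; rewrite eq_sym subr_eq; apply/eqP.
  apply: (@complexI R); rewrite rmorphD/= !rmorphXn/= !rnormE !sqr_normE.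
  by rewrite -[g in LHS](subrK (p n)) (hnormDd (form := innerdot H))/=.
apply/cvg_rnormP => r r0.
have r20 : 0 < r ^+ 2 by rewrite exprn_gt0.
have /cvgrPdist_lt /(_ _ r20) := @parseval g.
apply: filterS => n; rewrite -pE ger0_norm ?sqr_ge0//.
by rewrite ltr_pXn2r ?nnegrE ?rnorm_ge0// ltW.
Qed.

(** Square summable coefficients define a vector: the squared distance of two
    partial sums is the corresponding block of the convergent series
    sum |c k|^2. *)
Lemma riesz_fischer (c : nat -> R[i]) M :
  (forall n, \sum_(0 <= k < n | onb_dom e k) rnorm (c k : R[i]^o) ^+ 2 <= M) ->
  exists w : H,
    (fun n => \sum_(0 <= k < n | onb_dom e k) c k *: e k) @ \oo --> w.
Proof.
move=> hM; have oe := @onb_orthonormal _ _ e.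
pose s n := \sum_(0 <= k < n | onb_dom e k) rnorm (c k : R[i]^o) ^+ 2.
pose p n := \sum_(0 <= k < n | onb_dom e k) c k *: e k.
have snd : {homo s : n m / (n <= m)%N >-> n <= m}.
  move=> n m nm; rewrite /s [leRHS](big_cat_nat _ nm)//= lerDl sumr_ge0// => i _.
  exact: sqr_ge0.
have sc : cvgn s.
  by apply: nondecreasing_is_cvgn => //; exists M => _ [n _ <-]; exact: hM.
have pE n m : (n <= m)%N -> rnorm (p n - p m) ^+ 2 = s m - s n.
  move=> nm; rewrite rnorm_dist /p /s.
  rewrite [X in rnorm (X - _)](big_cat_nat _ nm)//=.
  rewrite [X in _ = X - _](big_cat_nat _ nm)//=.
  rewrite [X in rnorm (X - _)]addrC addrK [X in _ = X - _]addrC addrK.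
  rewrite (big_nat_widenl n 0)// [RHS](big_nat_widenl n 0)//.
  by apply: rnorm_sum_orth => i j /andP[Di _] /andP[Dj _]; exact: oe.
suff : cvg (p @ \oo) by move=> /cvg_ex[w pw]; exists w.
apply: cauchy_cvg; apply/cauchy_rnormP => r r0.
have r20 : 0 < r ^+ 2 by rewrite exprn_gt0.
have /cvgrPdist_lt /(_ _ r20) [N _ hN] := sc.
exists (p N); exists N => // m /= Nm.
(* |p N - p m|^2 = s m - s N is at most lim s - s N, by monotonicity. *)
have := hN N (leqnn N); rewrite /= => lN.
rewrite -(@ltr_pXn2r _ 2) ?nnegrE ?rnorm_ge0 ?(ltW r0)// pE//.
apply: le_lt_trans lN; apply: le_trans (ler_norm _).
by rewrite lerD2r; apply: nondecreasing_cvgn_le.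
Qed.

End parseval.

(** * The inner product with an elementary tensor *)

Section riesz.
Variables (R : realType) (H1 H2 : hilbertType R) (e : onb H2).
Implicit Types (T : tensor H1 e).

(** Antilinearity of T moves the coordinates <g, e_k> inside, so the series
    defining the left-hand side is <T (sum_k <g, e_k> e_k), f>. *)
Lemma inner_elementary T f g :
  inner T (elementary_tensor e f g) = inner (T g) f.
Proof.
have /hsP[aT cT _] := tensor_funP T; have [T0 TD _ TZ] := antilinearP aT.
apply: (@cvg_lim R[i]^o) => //.
have Tg := cvg_comp _ _ (@onb_expansion _ _ e g) (cT g).
refine (cvg_eqfun _ (inner_cvgl (x := f) Tg)) => n /=.
rewrite (big_morph T TD T0) (linear_sumlz (innerdot H1)).
apply: eq_bigr => k _ /=.
by rewrite TZ (linearZl_LR (innerdot H1))/= (linearZr_LR (innerdot H1)).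
Qed.

(** The Riesz vector of the antilinear functional u |-> <T u, f>, that is, the
    antilinear adjoint of T at f; its coordinates in e are <T e_k, f>. *)
Lemma riesz T f : exists w : H2, forall u, inner (T u) f = inner w u.
Proof.
have [|w cw] := @riesz_fischer _ _ e (fun k => inner (T (e k)) f)
  (rnorm T ^+ 2 * rnorm f ^+ 2).
  move=> n; apply: (@le_trans _ _ (psum e T n * rnorm f ^+ 2)); last first.
    by rewrite ler_wpM2r ?sqr_ge0// psum_le_rnorm.
  rewrite mulr_suml; apply: ler_sum => k _; rewrite -exprMn.
  by rewrite ler_sqr ?nnegrE ?mulr_ge0 ?rnorm_ge0// rnorm_inner_le.
exists w => u; rewrite -inner_elementary; apply: (@cvg_lim R[i]^o) => //.
refine (cvg_eqfun _ (inner_cvgl (x := u) cw)) => n /=.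
rewrite inner_sumZl; apply: eq_bigr => k _ /=.
by rewrite (linearZr_LR (innerdot H1))/= mulrC -innerC.
Qed.

End riesz.

(** * Measurability of complex-valued functions *)

Section complex_measurability.
Variables (R : realType) (d : measure_display) (Y : measurableType d).
Local Notation borelC := (g_sigma_algebraType (@open R[i]^o)).
Implicit Types f g : Y -> R[i].

Let ReB (z w : R[i]) : complex.Re (z - w) = complex.Re z - complex.Re w.
Proof. by case: z w => ? ? []. Qed.

Let ImB (z w : R[i]) : complex.Im (z - w) = complex.Im z - complex.Im w.
Proof. by case: z w => ? ? []. Qed.

(** Backwards, an open subset of the plane is the countable union of the open
    rectangles with rational corners that it contains. *)
Lemma measurable_complexP f : measurable_fun setT (f : Y -> borelC) <->
  measurable_fun setT (fun y => complex.Re (f y)) /\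
  measurable_fun setT (fun y => complex.Im (f y)).
Proof.
split=> [mf|[mr mi]].
  (* A 1-Lipschitz additive map is continuous; this covers Re and Im. *)
  have lipschitz_measurable (h : R[i] -> R) : (forall z w, h z - h w = h (z - w)) ->
      (forall z : R[i], `|h z| <= rnorm (z : R[i]^o)) ->
      measurable_fun setT (fun y => h (f y)).
    move=> hB hle.
    apply: (measurability _ (RGenOpens.measurableE R)) => _ [_ [a [b ->]] <-].
    rewrite setTI.
    have oh : open ((h : R[i]^o -> R) @^-1` `]a, b[%classic).
      apply: open_comp; last exact: interval_open.
      move=> z _; apply/(@cvgrPdist_lt _ R^o _ (nbhs (z : R[i]^o))) => r r0.
      apply/nbhs_ballP; exists r%:C; first by rewrite /= ltcR.
      move=> w; rewrite -ball_normE/= -rnormE ltcR; apply: le_lt_trans.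
      by rewrite hB; exact: hle.
    have := mf measurableT _ (@sub_sigma_algebra _ setT (@open R[i]^o) _ oh).
    by rewrite setTI.
  split; apply: lipschitz_measurable.
  - by move=> z w; rewrite ReB.
  - exact: Re_le_rnorm.
  - by move=> z w; rewrite ImB.
  - exact: Im_le_rnorm.
apply: (@measurability _ _ Y borelC setT f (@open R[i]^o)) => //.
move=> _ [U oU <-]; rewrite setTI.
pose rect (q : rat * rat * (rat * rat)) : set R[i] :=
  [set z | (ratr q.1.1 < complex.Re z < ratr q.1.2) &&
           (ratr q.2.1 < complex.Im z < ratr q.2.2)].
have -> : f @^-1` U = \bigcup_q (if `[< rect q `<=` U >] then f @^-1` rect q else set0).
  apply/seteqP; split=> [y Uy|y [q _]]; last first.
    by case: asboolP => // qU; exact: qU.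
  have [r /= r0 rU] : exists2 r : R, 0 < r &
      forall z, rnorm (f y - z : R[i]^o) < r -> U z.
    have /nbhs_ballP[r/= r0 rU] := oU _ Uy.
    move: r0; rewrite ltcE => /andP[/eqP/= ri r0].
    exists (complex.Re r) => // z zr; apply: rU; rewrite -ball_normE/=.
    by rewrite -rnormE; case: r ri r0 zr => a b /= -> _; rewrite ltcR.
  have r2 : 0 < r / 2 by rewrite divr_gt0.
  have ex (a : R) : exists p q : rat, ((ratr p < a) && (a < ratr q)) /\
      forall b, ratr p < b < ratr q -> `|a - b| < r / 2.
    have [|p] := @rat_in_itvoo R (a - r / 2) a; first by rewrite ltrBlDr ltrDl.
    have [|q] := @rat_in_itvoo R a (a + r / 2); first by rewrite ltrDl.
    rewrite !in_itv/= => /andP[aq qa] /andP[pa ap]; exists p, q.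
    rewrite ap aq; split => // b /andP[pb bq]; rewrite ltr_norml; apply/andP; split.
      by rewrite ltrBrDl ltrBlDr (lt_trans bq).
    by rewrite ltrBlDr -ltrBlDl (lt_trans pa).
  have [p1 [q1 [h1 b1]]] := ex (complex.Re (f y)).
  have [p2 [q2 [h2 b2]]] := ex (complex.Im (f y)).
  exists ((p1, q1), (p2, q2)) => //.
  case: asboolP => [_|[]]; first by rewrite /rect/= h1 h2.
  move=> z /= /andP[/b1 z1 /b2 z2]; apply: rU.
  apply: le_lt_trans (rnorm_le_ReIm _) _; rewrite [ltRHS]splitr ltrD//.
    by rewrite ReB.
  by rewrite ImB.
apply: countable_bigcupT_measurable; first exact: countableP.
move=> q; case: asboolP => // _.
have -> : f @^-1` rect q =
  ((fun y => complex.Re (f y)) @^-1` `]ratr q.1.1, ratr q.1.2[%classic) `&`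
  ((fun y => complex.Im (f y)) @^-1` `]ratr q.2.1, ratr q.2.2[%classic).
  by apply/seteqP; split=> y; rewrite /rect/= !in_itv/= => /andP.
apply: measurableI; rewrite -[X in measurable X]setTI.
  exact: mr.
exact: mi.
Qed.

Lemma measurable_complexM f g :
  measurable_fun setT (f : Y -> borelC) -> measurable_fun setT (g : Y -> borelC) ->
  measurable_fun setT (fun y => f y * g y : borelC).
Proof.
move=> /measurable_complexP[rf jf] /measurable_complexP[rg jg].
apply/measurable_complexP; split.
  rewrite (_ : (fun y => _) = (fun y => complex.Re (f y) * complex.Re (g y) -
      complex.Im (f y) * complex.Im (g y))).
    by apply: measurable_funB; apply: measurable_funM.
  by apply/funext => y; case: (f y) (g y) => ? ? [].
rewrite (_ : (fun y => _) = (fun y => complex.Re (f y) * complex.Im (g y) +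
    complex.Im (f y) * complex.Re (g y))).
  by apply: measurable_funD; apply: measurable_funM.
by apply/funext => y; case: (f y) (g y) => ? ? [].
Qed.

Lemma measurable_complexZ (c : R[i]) f : c != 0 ->
  measurable_fun setT (fun y => c * f y : borelC) ->
  measurable_fun setT (f : Y -> borelC).
Proof.
move=> c0 mf; rewrite (_ : f = fun y => c^-1 * (c * f y)); last first.
  by apply/funext => y; rewrite mulKf.
by apply: (@measurable_complexM (fun=> c^-1)) => //; exact: measurable_cst.
Qed.

Lemma measurable_complex_sum I (r : seq I) (P : pred I) (h : I -> Y -> R[i]) :
  (forall i, P i -> measurable_fun setT (h i : Y -> borelC)) ->
  measurable_fun setT (fun y => \sum_(i <- r | P i) h i y : borelC).
Proof.
move=> mh; apply/measurable_complexP; split.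
  under eq_fun do rewrite Re_sum big_mkcond.
  apply: measurable_sum => i; have := mh i.
  case: (P i) => [/(_ isT) mi|_]; last exact: measurable_cst.
  by have /measurable_complexP[] := mi.
under eq_fun do rewrite Im_sum big_mkcond.
apply: measurable_sum => i; have := mh i.
case: (P i) => [/(_ isT) mi|_]; last exact: measurable_cst.
by have /measurable_complexP[] := mi.
Qed.

Lemma measurable_complex_cvg (h : nat -> Y -> R[i]) f :
  (forall n, measurable_fun setT (h n : Y -> borelC)) ->
  (forall y, (fun n => h n y : R[i]^o) @ \oo --> (f y : R[i]^o)) ->
  measurable_fun setT (f : Y -> borelC).
Proof.
move=> mh hf; apply/measurable_complexP; split.
  apply: (@measurable_fun_cvg _ _ _ _ (fun n y => complex.Re (h n y))).
    by move=> n; have /measurable_complexP[] := mh n.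
  move=> y _; apply/cvgrPdist_lt => r r0.
  have /cvg_rnormP/(_ _ r0) := hf y; apply: filterS => n; apply: le_lt_trans.
  by rewrite -ReB; exact: Re_le_rnorm.
apply: (@measurable_fun_cvg _ _ _ _ (fun n y => complex.Im (h n y))).
  by move=> n; have /measurable_complexP[] := mh n.
move=> y _; apply/cvgrPdist_lt => r r0.
have /cvg_rnormP/(_ _ r0) := hf y; apply: filterS => n; apply: le_lt_trans.
by rewrite -ImB; exact: Im_le_rnorm.
Qed.

Lemma measurable_sqr_rnorm f : measurable_fun setT (f : Y -> borelC) ->
  measurable_fun setT (fun y => (rnorm (f y : R[i]^o) ^+ 2)%:E).
Proof.
move=> /measurable_complexP[mr mi]; apply/measurable_EFinP.
rewrite (_ : (fun y => _) = fun y => complex.Re (f y) ^+ 2 + complex.Im (f y) ^+ 2).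
  by apply: measurable_funD; apply: measurable_funX.
apply/funext => y; case: (f y) => a b; rewrite /rnorm normc_def/=.
by rewrite sqr_sqrtr// addr_ge0 ?sqr_ge0.
Qed.

End complex_measurability.

(** * Maps that agree pointwise up to a phase *)

Section unimodular.
Variable R : realType.

Lemma norm_phase (t : R) : `|cos t +i* sin t| = 1 :> R[i].
Proof. by rewrite normc_def/= cos2Dsin2 sqrtr1. Qed.

(** Fix u0 with S u0 != 0, of phase c0.  If S u is a multiple of S u0, then
    u differs from a multiple of u0 by an element of the kernel of S, on which
    T vanishes too, so u has phase c0.  If S u and S u0 are independent,
    comparing coefficients at u + u0 gives the common phase. *)
Lemma phase_uniform (U V : hilbertType R) (T S : U -> V) :
  antilinear T -> antilinear S ->
  (forall u, exists t : R, T u = (cos t +i* sin t) *: S u) ->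
  exists t : R, forall u, T u = (cos t +i* sin t) *: S u.
Proof.
move=> /antilinearP[T0 TD TB TZ] /antilinearP[S0 SD SB SZ] TS.
have [S_eq0|/existsNP[u0 /eqP Su0]] := pselect (forall u, S u = 0).
  by exists 0 => u; have [t ->] := TS u; rewrite S_eq0 !scaler0.
have [t0 Tu0] := TS u0; exists t0 => u; have [t Tu] := TS u.
have [[a Sua]|indep] := pselect (exists a, S u = a *: S u0).
  (* The conjugate compensates the antilinearity of S and T. *)
  have Sv : S (u - Num.conj a *: u0) = 0 by rewrite SB SZ conjCK Sua subrr.
  have [t1] := TS (u - Num.conj a *: u0).
  rewrite Sv scaler0 TB TZ conjCK => /eqP; rewrite subr_eq0 => /eqP ->.
  by rewrite Tu0 Sua !scalerA mulrC.
have [t1] := TS (u + u0); rewrite TD SD Tu Tu0 => eqTS.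
set c0 := cos t0 +i* sin t0 in eqTS *; set c := cos t +i* sin t in eqTS *.
set c1 := cos t1 +i* sin t1 in eqTS.
have eqc : (c - c1) *: S u = (c1 - c0) *: S u0.
  apply/eqP; rewrite !scalerBl subr_eq addrAC -subr_eq opprK eqTS.
  by rewrite scalerDr addrC.
have cc1 : c = c1.
  apply: contrapT => /eqP; rewrite -subr_eq0 => cc1; apply: indep.
  exists ((c - c1)^-1 * (c1 - c0)).
  by rewrite -scalerA -eqc scalerA mulVf// scale1r.
move: eqc; rewrite cc1 subrr scale0r => /esym/eqP.
by rewrite scaler_eq0 (negbTE Su0) orbF subr_eq0 => /eqP ->.
Qed.

End unimodular.

(** * Frame bounds *)

Section frame_energy.
Variables (R : realType) (d : measure_display) (Y : measurableType d).
Variables (nu : {measure set Y -> \bar R}) (K : hilbertType R).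
Implicit Types (Phi : Y -> K) (f : K).

Definition frame_measurable Phi := forall f : K, measurable_fun setT
  (fun y => inner f (Phi y) : g_sigma_algebraType (@open R[i]^o)).

Definition frame_energy Phi f : \bar R :=
  (\int[nu]_y (rnorm (inner f (Phi y) : R[i]^o) ^+ 2)%:E)%E.

Definition frame_bounds Phi (A B : R) := forall f,
  ((A * rnorm f ^+ 2)%:E <= frame_energy Phi f <= (B * rnorm f ^+ 2)%:E)%E.

Lemma frame_energy_ge0 Phi f : (0 <= frame_energy Phi f)%E.
Proof. by apply: integral_ge0 => y _; rewrite lee_fin sqr_ge0. Qed.

(** If the energies multiplied by a fixed J satisfy two-sided bounds, then J is
    neither 0, by the lower bound, nor infinite, by the upper bound, at a
    nonzero vector; dividing by J gives frame bounds.  Here J will be the energy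
    of a fixed vector of the other factor, and m the square of its norm. *)
Lemma frame_bounds_cofactor Phi (A B m : R) (J : \bar R) :
  (exists f : K, f != 0) -> 0 < A -> A <= B -> 0 < m -> (0 <= J)%E ->
  (forall f, ((A * (rnorm f ^+ 2 * m))%:E <= frame_energy Phi f * J
                <= (B * (rnorm f ^+ 2 * m))%:E)%E) ->
  exists A' B', [/\ 0 < A', A' <= B' & frame_bounds Phi A' B'].
Proof.
move=> [f0 f0n] A0 AB m0 J0 bnd.
have rf0 : 0 < rnorm f0 ^+ 2 by rewrite exprn_gt0// rnorm_gt0.
have [lb ub] := andP (bnd f0).
have EJ : (0 < frame_energy Phi f0 * J)%E.
  by apply: lt_le_trans lb; rewrite lte_fin mulr_gt0// mulr_gt0.
have E0 : (0 < frame_energy Phi f0)%E.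
  rewrite lt_neqAle frame_energy_ge0 andbT; apply/eqP => E0.
  by rewrite -E0 mul0e ltxx in EJ.
have {}J0 : (0 < J)%E.
  rewrite lt_neqAle J0 andbT; apply/eqP => J00.
  by rewrite -J00 mule0 ltxx in EJ.
case: J bnd {lb EJ} ub J0 => [j| |//] bnd ub j0; last first.
  by rewrite gt0_muley// leye_eq in ub.
rewrite lte_fin in j0.
exists (A * m / j), (B * m / j); split.
- by rewrite !mulr_gt0// invr_gt0.
- by rewrite ler_pM2r ?invr_gt0// ler_pM2r.
move=> f; have /andP[lf uf] := bnd f.
have E (c : R) : c * m / j * rnorm f ^+ 2 = c * (rnorm f ^+ 2 * m) / j by ring.
rewrite !E; apply/andP; split.
  by rewrite EFinM lee_pdivrMr.
by rewrite EFinM lee_pdivlMr.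
Qed.

End frame_energy.

(** * Null sets of a product measure *)

Section almost_everywhere_product.
Variables (R : realType) (d1 d2 : measure_display).
Variables (X1 : measurableType d1) (X2 : measurableType d2).
Variables (mu1 : {sigma_finite_measure set X1 -> \bar R}).
Variables (mu2 : {sigma_finite_measure set X2 -> \bar R}).

(** The product measure of a null set is the integral of the measures of its
    sections, so almost every section is null. *)
Lemma ae_section (P : X1 * X2 -> Prop) :
  {ae (mu1 \x mu2)%E, forall x, P x} ->
  {ae mu1, forall x1, {ae mu2, forall x2, P (x1, x2)}}.
Proof.
move=> [N [mN N0 PN]].
have mNx := measurable_fun_xsection mu2 mN.
have : ae_eq mu1 setT (mu2 \o xsection N) (cst 0%E).
  apply/(ae_eq_integral_abs mu1 measurableT mNx).
  by rewrite -[RHS]N0; apply: eq_integral => x _; rewrite gee0_abs.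
apply: filterS => x1 /(_ I) /= Nx1.
exists (xsection N x1); split => //; first exact: measurable_xsection.
by move=> x2 nP; apply/xsectionP/PN.
Qed.

Lemma ae_fst (P : X1 -> Prop) : {ae mu1, forall x1, P x1} ->
  {ae (mu1 \x mu2)%E, forall x, P x.1}.
Proof.
move=> [N [mN N0 PN]]; exists (N `*` setT); split.
- exact: measurableX.
- transitivity (mu1 N * mu2 setT)%E; first exact: product_measure1E.
  by rewrite N0 mul0e.
- by move=> x nP; split => //; exact: PN.
Qed.

Lemma ae_snd (P : X2 -> Prop) : {ae mu2, forall x2, P x2} ->
  {ae (mu1 \x mu2)%E, forall x, P x.2}.
Proof.
move=> [N [mN N0 PN]]; exists (setT `*` N); split.
- exact: measurableX.
- transitivity (mu1 setT * mu2 N)%E; first exact: product_measure1E.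
  by rewrite N0 mule0.
- by move=> x nP; split => //; exact: PN.
Qed.

End almost_everywhere_product.

(** * The tensor product of two frames *)

Lemma nneseries_EFin (R : realType) (D : pred nat) (a : nat -> R) (l : R) :
  (fun n => \sum_(0 <= k < n | D k) a k) @ \oo --> l ->
  (\sum_(0 <= k <oo | D k) (a k)%:E)%E = l%:E.
Proof.
move=> al; rewrite -(cvg_lim _ al)// -EFin_lim; last by apply/cvg_ex; exists l.
by congr (limn _); apply/funext => n /=; rewrite sumEFin.
Qed.

Section tensor_frame.
Variables (R : realType) (H1 H2 : hilbertType R) (e : onb H2).
Variables (d1 d2 : measure_display).
Variables (X1 : measurableType d1) (X2 : measurableType d2).
Variables (mu1 : {sigma_finite_measure set X1 -> \bar R}).
Variables (mu2 : {sigma_finite_measure set X2 -> \bar R}).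
Variables (F1 : X1 -> H1) (F2 : X2 -> H2).
Local Notation F := (tensor_map e F1 F2).
Local Notation sqm z := ((rnorm (z : R[i]^o) ^+ 2)%:E).
Implicit Types (f : H1) (g : H2) (T S : tensor H1 e).

Lemma inner_tensor_map T x : inner T (F x) = inner (T (F2 x.2)) (F1 x.1).
Proof. exact: inner_elementary. Qed.

Lemma inner_elementary_tensor_map f g x :
  inner (elementary_tensor e f g) (F x) = inner g (F2 x.2) * inner f (F1 x.1).
Proof. by rewrite inner_tensor_map/= (linearZl_LR (innerdot H1)). Qed.

(** The coefficient is, by definition of the inner product, a pointwise limit of
    finite sums of products of coefficients of F1 and F2. *)
Lemma tensor_map_measurable :
  frame_measurable F1 -> frame_measurable F2 -> frame_measurable F.
Proof.
move=> m1 m2 T.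
apply: (@measurable_complex_cvg _ _ _ (fun n x =>
  \sum_(0 <= k < n | onb_dom e k)
    inner (e k) (F2 x.2) * inner (T (e k)) (F1 x.1))).
  move=> n; apply: measurable_complex_sum => k _; apply: measurable_complexM.
    exact: (measurableT_comp (m2 (e k)) measurable_snd).
  exact: (measurableT_comp (m1 (T (e k))) measurable_fst).
move=> x; refine (cvg_eqfun _ (hs_inner_cvg (tensor_funP T) (tensor_funP (F x)))).
move=> n; apply: eq_bigr => k _ /=.
by rewrite (linearZr_LR (innerdot H1))/= -innerC.
Qed.

Lemma frame_energy_tonelli T : frame_measurable F ->
  frame_energy (mu1 \x mu2)%E F T =
  (\int[mu1]_x1 \int[mu2]_x2 sqm (inner T (F (x1, x2))))%E.
Proof.
move=> mF; apply: fubini_tonelli1; first exact: measurable_sqr_rnorm.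
by move=> x; rewrite lee_fin sqr_ge0.
Qed.

Lemma frame_energy_elementary f g :
  frame_measurable F1 -> frame_measurable F2 ->
  frame_energy (mu1 \x mu2)%E F (elementary_tensor e f g) =
  (frame_energy mu1 F1 f * frame_energy mu2 F2 g)%E.
Proof.
move=> m1 m2; rewrite frame_energy_tonelli; last exact: tensor_map_measurable.
under eq_integral => x1 _.
  under eq_integral => x2 _.
    rewrite inner_elementary_tensor_map rnorm_scalarM exprMn EFinM.
    over.
  rewrite /= ge0_integralZr//; last 3 first.
  - exact: measurable_sqr_rnorm.
  - by move=> x2 _; rewrite lee_fin sqr_ge0.
  - by rewrite lee_fin sqr_ge0.
  over.
rewrite ge0_integralZl//; last 3 first.
- exact: measurable_sqr_rnorm.
- by move=> x1 _; rewrite lee_fin sqr_ge0.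
- by apply: integral_ge0 => x2 _; rewrite lee_fin sqr_ge0.
by rewrite muleC.
Qed.

Lemma parseval_series g :
  (\sum_(0 <= k <oo | onb_dom e k) sqm (inner g (e k)))%E = (rnorm g ^+ 2)%:E.
Proof. by apply: nneseries_EFin; exact: parseval. Qed.

Lemma sqr_rnorm_series T :
  (\sum_(0 <= k <oo | onb_dom e k) (rnorm (T (e k)) ^+ 2)%:E)%E =
  (rnorm T ^+ 2)%:E.
Proof.
by apply: nneseries_EFin; rewrite tensor_rnorm; exact/psum_cvg/tensor_funP.
Qed.

(** The F2-energy of the Riesz vector w(x1) is pinched between A2 |w(x1)|^2 and
    B2 |w(x1)|^2, and the integral over x1 of |w(x1)|^2 is, by Parseval, the
    sum of the F1-energies of the vectors T e_k. *)
Lemma frame_bounds_tensor A1 B1 A2 B2 : 0 <= A1 -> 0 <= A2 -> 0 <= B2 ->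
  frame_measurable F1 -> frame_measurable F2 ->
  frame_bounds mu1 F1 A1 B1 -> frame_bounds mu2 F2 A2 B2 ->
  frame_bounds (mu1 \x mu2)%E F (A2 * A1) (B2 * B1).
Proof.
move=> A10 A20 B20 m1 m2 b1 b2 T.
have mF := tensor_map_measurable m1 m2.
have [w hw] := choice (fun x1 => riesz T (F1 x1)).
have EF x1 : (\int[mu2]_x2 sqm (inner T (F (x1, x2))))%E = frame_energy mu2 F2 (w x1).
  by apply: eq_integral => x2 _; rewrite inner_tensor_map hw.
pose W x1 : \bar R := (rnorm (w x1) ^+ 2)%:E.
have W0 x1 : (0 <= W x1)%E by rewrite lee_fin sqr_ge0.
have WE : W = fun x1 => (\sum_(0 <= k <oo | onb_dom e k) sqm (inner (T (e k)) (F1 x1)))%E.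
  apply/funext => x1; rewrite /W -parseval_series.
  by apply: eq_eseriesr => k _; rewrite hw.
have mW : measurable_fun setT W.
  rewrite WE; apply: (@ge0_emeasurable_sum _ _ _ _ _ (onb_dom e)) => //.
    by move=> k x1 _ _; rewrite lee_fin sqr_ge0.
  by move=> k _; exact: measurable_sqr_rnorm.
have IW : (\int[mu1]_x1 W x1 =
    \sum_(0 <= k <oo | onb_dom e k) frame_energy mu1 F1 (T (e k)))%E.
  under eq_integral do rewrite WE eseries_mkcond.
  rewrite integral_nneseries//.
  - rewrite [RHS]eseries_mkcond; apply: eq_eseriesr => k _.
    by case: (onb_dom e k) => //; rewrite integral0.
  - move=> k; case: (onb_dom e k); first exact: measurable_sqr_rnorm.
    exact: measurable_cst.
  - by move=> k x1 _; case: (onb_dom e k) => //; rewrite lee_fin sqr_ge0.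
have mE : measurable_fun setT (fun x1 => frame_energy mu2 F2 (w x1)).
  rewrite (_ : (fun x1 => _) = fubini_F mu2 (fun x => sqm (inner T (F x)))).
    apply: measurable_fun_fubini_tonelli_F; first exact: measurable_sqr_rnorm.
    by move=> x; rewrite lee_fin sqr_ge0.
  by apply/funext => x1; rewrite -EF.
have Z (c : R) : 0 <= c ->
    (\int[mu1]_x1 (c * rnorm (w x1) ^+ 2)%:E = c%:E * \int[mu1]_x1 W x1)%E.
  by move=> c0; rewrite -ge0_integralZl.
have mZ (c : R) : measurable_fun setT (fun x1 => (c * rnorm (w x1) ^+ 2)%:E).
  by under eq_fun do rewrite EFinM; exact: measurable_funeM.
have S (c : R) : (\sum_(0 <= k <oo | onb_dom e k) (c * rnorm (T (e k)) ^+ 2)%:E)%E =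
    (c * rnorm T ^+ 2)%:E.
  rewrite EFinM -sqr_rnorm_series -nneseriesZl//.
  by move=> k _; rewrite lee_fin sqr_ge0.
rewrite frame_energy_tonelli//; under eq_integral do rewrite EF.
apply/andP; split.
  apply: (@le_trans _ _ (\int[mu1]_x1 (A2 * rnorm (w x1) ^+ 2)%:E)%E).
    rewrite Z// -mulrA EFinM lee_wpmul2l ?lee_fin// IW -S.
    apply: lee_nneseries => [k _ _|k _]; first by rewrite lee_fin mulr_ge0 ?sqr_ge0.
    by have /andP[] := b1 (T (e k)).
  apply: ge0_le_integral => //.
    by move=> x1 _; rewrite lee_fin mulr_ge0 ?sqr_ge0.
  by move=> x1 _; have /andP[] := b2 (w x1).
apply: (@le_trans _ _ (\int[mu1]_x1 (B2 * rnorm (w x1) ^+ 2)%:E)%E).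
  apply: ge0_le_integral => //.
    by move=> x1 _; exact: frame_energy_ge0.
  by move=> x1 _; have /andP[] := b2 (w x1).
rewrite Z// -[X in (_ <= X%:E)%E]mulrA EFinM lee_wpmul2l ?lee_fin// IW -S.
apply: lee_nneseries => [k _ _|k _]; first exact: frame_energy_ge0.
by have /andP[] := b1 (T (e k)).
Qed.

(** Slicing along x1 and applying the hypothesis on F2 to the Riesz vectors of
    T and S replaces F2 x2 by an arbitrary u, after which F1 applies. *)
Lemma phase_retrieval_tensor :
  phase_retrieval mu1 F1 -> phase_retrieval mu2 F2 ->
  phase_retrieval (mu1 \x mu2)%E F.
Proof.
move=> p1 p2 T S /ae_section TS.
have /hsP[aT _ _] := tensor_funP T; have /hsP[aS _ _] := tensor_funP S.
have TSu u : exists t : R, T u = (cos t +i* sin t) *: S u.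
  apply: p1; move: TS; apply: filterS => x1 TSx1.
  have [w hw] := riesz T (F1 x1); have [v hv] := riesz S (F1 x1).
  have [|t wv] := p2 w v.
    by move: TSx1; apply: filterS => x2; rewrite !inner_tensor_map hw hv.
  by rewrite hw hv wv (linearZl_LR (innerdot H2))/= normrM norm_phase mul1r.
have [t tE] := phase_uniform aT aS TSu.
by exists t; apply/val_inj/funext => u; exact: tE.
Qed.

Lemma phase_retrieval_fst : (exists g : H2, g != 0) ->
  phase_retrieval (mu1 \x mu2)%E F -> phase_retrieval mu1 F1.
Proof.
move=> [g g0] p f f' ff'.
have [|t tE] := p (elementary_tensor e f g) (elementary_tensor e f' g).
  have := ae_fst mu2 ff'; apply: filterS => x ffx.
  by rewrite !inner_elementary_tensor_map !normrM ffx.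
exists t.
have : inner g g *: f = (cos t +i* sin t) *: (inner g g *: f').
  exact: (congr1 (fun T : tensor H1 e => T g) tE).
rewrite scalerA mulrC -scalerA => /scalerI; apply.
by rewrite -sqr_normE sqrf_eq0 normr_eq0.
Qed.

(** From f (x) g = f (x) c g' the vector h = g - c g' satisfies
    <g, h> f = c <g', h> f, that is, <h, h> = 0. *)
Lemma phase_retrieval_snd : (exists f : H1, f != 0) ->
  phase_retrieval (mu1 \x mu2)%E F -> phase_retrieval mu2 F2.
Proof.
move=> [f f0] p g g' gg'.
have [|t tE] := p (elementary_tensor e f g) (elementary_tensor e f g').
  have := ae_snd mu1 gg'; apply: filterS => x ggx.
  by rewrite !inner_elementary_tensor_map !normrM ggx.
exists t; apply/eqP; rewrite -subr_eq0 -(dnorm_eq0 (innerdot H2)); apply/eqP => /=.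
set h := g - _; rewrite (linearBl (innerdot H2))/= (linearZl_LR (innerdot H2))/=.
have : inner g h *: f = (cos t +i* sin t) *: (inner g' h *: f).
  exact: (congr1 (fun T : tensor H1 e => T h) tE).
move=> /eqP; rewrite scalerA -subr_eq0 -scalerBl scaler_eq0 (negbTE f0) orbF.
by move=> /eqP.
Qed.

(** Otherwise every coefficient vanishes, against the lower frame bound at a
    nonzero elementary tensor.  Such a point provides nonvanishing slices. *)
Lemma tensor_map_nonzero (A : R) : 0 < A ->
  (exists f : H1, f != 0) -> (exists g : H2, g != 0) ->
  (forall T, ((A * rnorm T ^+ 2)%:E <= frame_energy (mu1 \x mu2)%E F T)%E) ->
  exists x, F1 x.1 != 0 /\ F2 x.2 != 0.
Proof.
move=> A0 [f f0] [g g0] lb; apply: contrapT => noF.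
have := lb (elementary_tensor e f g); rewrite rnorm_elementary.
rewrite /frame_energy integral0_eq.
  by rewrite lee_fin leNgt mulr_gt0// exprn_gt0// mulr_gt0// rnorm_gt0.
move=> x _; rewrite inner_elementary_tensor_map.
have [F1x|F1x] := eqVneq (F1 x.1) 0.
  by rewrite F1x (linear0r (innerdot H1)) mulr0 rnorm0 expr0n.
have [F2x|F2x] := eqVneq (F2 x.2) 0.
  by rewrite F2x (linear0r (innerdot H2)) mul0r rnorm0 expr0n.
by exfalso; apply: noF; exists x.
Qed.

(** On the slice x2, the coefficients of f (x) F2 x2 are those of f multiplied
    by the nonzero constant |F2 x2|^2. *)
Lemma frame_measurable_fst x2 : F2 x2 != 0 ->
  frame_measurable F -> frame_measurable F1.
Proof.
move=> F2x mF f; apply: (@measurable_complexZ _ _ _ (inner (F2 x2) (F2 x2))).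
  by rewrite -sqr_normE sqrf_eq0 normr_eq0.
have := measurable_fun_pair1 x2 (mF (elementary_tensor e f (F2 x2))).
by under eq_fun do rewrite inner_elementary_tensor_map.
Qed.

Lemma frame_measurable_snd x1 : F1 x1 != 0 ->
  frame_measurable F -> frame_measurable F2.
Proof.
move=> F1x mF g; apply: (@measurable_complexZ _ _ _ (inner (F1 x1) (F1 x1))).
  by rewrite -sqr_normE sqrf_eq0 normr_eq0.
have := measurable_fun_pair2 x1 (mF (elementary_tensor e (F1 x1) g)).
by under eq_fun do rewrite inner_elementary_tensor_map mulrC.
Qed.

End tensor_frame.

Theorem theorem5p2 (R : realType) (H1 H2 : hilbertType R)
    (H1_separable : separable_space H1) (H2_separable : separable_space H2)
    (H1_nontrivial : exists f : H1, f != 0)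
    (H2_nontrivial : exists g : H2, g != 0)
    (e : onb H2)
    (d1 d2 : measure_display)
    (X1 : measurableType d1) (X2 : measurableType d2)
    (mu1 : {sigma_finite_measure set X1 -> \bar R})
    (mu2 : {sigma_finite_measure set X2 -> \bar R})
    (F1 : X1 -> H1) (F2 : X2 -> H2) :
  phase_retrieval_frame (mu1 \x mu2)%E (tensor_map e F1 F2) <->
  phase_retrieval_frame mu1 F1 /\ phase_retrieval_frame mu2 F2.
Proof.
split=> [[[mF [A [B [A0 AB bF]]]] pF]|]; last first.
  move=> [[[m1 [A1 [B1 [A10 AB1 b1]]]] p1] [[m2 [A2 [B2 [A20 AB2 b2]]]] p2]].
  have B20 : 0 < B2 by exact: lt_le_trans AB2.
  split; last exact: phase_retrieval_tensor.
  split; first exact: tensor_map_measurable.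
  exists (A2 * A1), (B2 * B1); split.
  - exact: mulr_gt0.
  - by apply: ler_pM => //; exact: ltW.
  - by apply: frame_bounds_tensor => //; exact: ltW.
have [x [F1x F2x]] := tensor_map_nonzero A0 H1_nontrivial H2_nontrivial
  (fun T => proj1 (andP (bF T))).
have m1 := frame_measurable_fst F2x mF; have m2 := frame_measurable_snd F1x mF.
have bE f g : ((A * (rnorm f * rnorm g) ^+ 2)%:E <=
    frame_energy mu1 F1 f * frame_energy mu2 F2 g <=
    (B * (rnorm f * rnorm g) ^+ 2)%:E)%E.
  by rewrite -(frame_energy_elementary e)// -(rnorm_elementary e); exact: bF.
have pos (K : hilbertType R) (h : K) : h != 0 -> 0 < rnorm h ^+ 2.
  by move=> h0; rewrite exprn_gt0// rnorm_gt0.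
split; split; [split=> //| | split=> //|].
- apply: (frame_bounds_cofactor (J := frame_energy mu2 F2 (F2 x.2)) H1_nontrivial
    A0 AB (pos _ _ F2x)); first exact: frame_energy_ge0.
  by move=> f; rewrite -exprMn.
- exact: phase_retrieval_fst pF.
- apply: (frame_bounds_cofactor (J := frame_energy mu1 F1 (F1 x.1)) H2_nontrivial
    A0 AB (pos _ _ F1x)); first exact: frame_energy_ge0.
  by move=> g; rewrite -exprMn [rnorm g * _]mulrC muleC.
- exact: phase_retrieval_snd pF.
Qed.
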